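(* Let $X$ be a non-empty finite set and let $V^1,\dots,V^n:\Delta(X)\to\mathbb{R}$ be continuous functions. For $\mu\in\Delta(X)$ let $$\mathcal{V}(\mu)=\left\{\left(E_P[V^1],\dots,E_P[V^n]\right)\ :\ P\in\Delta^2(X),\ E_P[\nu]=\mu\right\}\subset\mathbb{R}^n.$$ Then the correspondence $\mathcal{V}:\Delta(X)\rightrightarrows\mathbb{R}^n$ is continuous (both upper and lower hemicontinuous), and its graph $\mathrm{Gr}(\mathcal{V})=\{(\mu,v):\mu\in\Delta(X),\ v\in\mathcal{V}(\mu)\}$ is convex and compact.
   Context: $\Delta(X)\subset\mathbb{R}^{|X|}$ is the simplex of probability measures on the finite set $X$ (with the Euclidean topology), and $\Delta^2(X)$ is the set of all Borel probability measures on $\Delta(X)$. For $P\in\Delta^2(X)$, $E_P[\nu]=\int_{\Delta(X)}\nu\,dP(\nu)$ is the barycenter and $E_P[V]=\int_{\Delta(X)}V(\nu)\,dP(\nu)$. *)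

(* Defs.v *)
From HB Require Import structures.
From mathcomp Require Import all_boot all_order all_algebra.
From mathcomp Require Import all_classical all_reals all_analysis.

Set Implicit Arguments.
Unset Strict Implicit.
Unset Printing Implicit Defensive.

Import Order.TTheory GRing.Theory Num.Theory.
Import numFieldNormedType.Exports.

Local Open Scope classical_set_scope.
Local Open Scope ring_scope.

(* Coordinate [i] of a vector of R^|X| is the mass of the point [enum_val i]. *)
Definition simplex (R : realType) (X : finType) : set 'rV[R]_#|X| :=
  [set nu | (forall i, 0 <= nu 0 i) /\ \sum_i nu 0 i = 1].
Arguments simplex R X : clear implicits.

(* The simplex as a topological space of its own. [measurableType]s are
   pointed, so Borel measures can only be formed on an inhabited type: the
   non-emptiness of [X] is kept as a parameter, used only for that purpose. *)
Definition Delta (R : realType) (X : finType) (X_gt0 : (0 < #|X|)%N) : Type :=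
  set_type (simplex R X).

HB.instance Definition _ (R : realType) (X : finType) (X_gt0 : (0 < #|X|)%N) :=
  Topological.copy (@Delta R X X_gt0) (set_type (simplex R X)).

Lemma simplex_delta_mx (R : realType) (X : finType) (i : 'I_#|X|) :
  delta_mx 0 i \in simplex R X.
Proof.
apply/mem_set; split=> [j|]; first by rewrite mxE; case: (_ && _).
rewrite (bigD1 i) //= mxE !eqxx /= big1 ?addr0 // => j /negbTE ji.
by rewrite mxE ji andbF.
Qed.

HB.instance Definition _ (R : realType) (X : finType) (X_gt0 : (0 < #|X|)%N) :=
  isPointed.Build (@Delta R X X_gt0)
    (exist (fun nu => nu \in simplex R X) _
      (simplex_delta_mx R (Ordinal X_gt0))).

Definition Delta_val (R : realType) (X : finType) (X_gt0 : (0 < #|X|)%N)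
  (nu : Delta R X_gt0) : 'rV[R]_#|X| := set_val nu.

Definition borel (T : ptopologicalType) := g_sigma_algebraType (@open T).

Definition Delta2 (R : realType) (X : finType) (X_gt0 : (0 < #|X|)%N) :=
  probability (borel (Delta R X_gt0)) R.

Section value_correspondence.
Context {R : realType} {X : finType} {X_gt0 : (0 < #|X|)%N}.

Definition barycenter (P : Delta2 R X_gt0) : 'rV[R]_#|X| :=
  \row_i \int[P]_nu (Delta_val (nu : Delta R X_gt0) 0 i).

Definition expectations n (V : 'I_n -> Delta R X_gt0 -> R)
    (P : Delta2 R X_gt0) : 'rV[R]_n :=
  \row_j \int[P]_nu (V j nu).

Definition value_set n (V : 'I_n -> Delta R X_gt0 -> R)
    (mu : Delta R X_gt0) : set 'rV[R]_n :=
  [set expectations V P | P in [set P | barycenter P = Delta_val mu]].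

(* The graph is taken in the vector space R^|X| x R^n, so that convexity
   makes sense. *)
Definition graph n (F : Delta R X_gt0 -> set 'rV[R]_n) :
    set ('rV[R]_#|X| * 'rV[R]_n) :=
  [set p | exists2 mu, p.1 = Delta_val mu & F mu p.2].

End value_correspondence.

Section hemicontinuity.
Context {T U : topologicalType}.
Implicit Type F : T -> set U.

Definition upper_hemicontinuous F :=
  forall x (O : set U), open O -> F x `<=` O ->
    \forall y \near x, F y `<=` O.

Definition lower_hemicontinuous F :=
  forall x (O : set U), open O -> F x `&` O !=set0 ->
    \forall y \near x, F y `&` O !=set0.

End hemicontinuity.

(* Main.v *)
Require Import Defs.
From HB Require Import structures.
From mathcomp Require Import all_boot all_order all_algebra.
From mathcomp Require Import all_classical all_reals all_analysis.
From mathcomp Require Import measurable_realfun.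
From mathcomp Require Import ring lra.
Import Order.TTheory GRing.Theory Num.Theory.
Import numFieldNormedType.Exports.
Set Implicit Arguments.
Unset Strict Implicit.
Unset Printing Implicit Defensive.
Local Open Scope classical_set_scope.
Local Open Scope ring_scope.

(** Write [phi nu = (nu, V nu)] for the point of R^|X| x R^n given by a prior
[nu].  Both the barycenter and the expected values of a law [P] on the simplex
are integrals of coordinates of [phi], so the graph of the correspondence is
the set of all vectors [E_P[phi]] ([graph_moments]).  Such vectors are the
convex combinations of the points [phi nu], and everything follows from that.

Convexity: a mixture of two laws has the corresponding mixture of moments
([graph_convex]).  Since Dirac masses put every [phi nu] in the graph, the graph
contains all finite convex combinations of these points.

Compactness: by Caratheodory's theorem ([caratheodory]), [m] points suffice for
a convex combination as soon as [m] exceeds the dimension; the set [C] of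
combinations of [m] points of the compact set [phi(Delta)] is the continuous
image of a compact product, hence compact.  It remains to see that every
[z = E_P[phi]] is in [C] ([graph_hull]).  Let [p] be the point of [C] nearest to
[z].  The segment from [p] to any [phi nu] uses one more point, hence stays in
[C] by Caratheodory, so that [phi nu - p] makes a right or obtuse angle with
[z - p] ([nearest_point]).  Integrating this over [nu] gives
[|z - p|^2 <= 0], so [z = p].

Upper hemicontinuity is a general property of correspondences with a compact
graph ([compact_graph_uhc]).

Lower hemicontinuity depends on the simplex being a polytope.  If [mu'] is
close to [mu], then [mu' >= lambda mu] coordinatewise for a given [lambda < 1],
because only the finitely many positive coordinates of [mu] matter.  Hence
[mu' = lambda mu + (1 - lambda) rho] for some [rho] in the simplex, and
convexity of the graph moves a value [v] at [mu] to the value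
[lambda v + (1 - lambda) V rho] at [mu'], which is close to [v] since [V] is
bounded ([value_set_split], [value_set_lhc]). *)

(** * Convex combinations and Caratheodory's theorem *)

Definition prob_vec (R : numDomainType) (m : nat) : set 'rV[R]_m :=
  [set w | (forall i, 0 <= w 0 i) /\ \sum_i w 0 i = 1].
Arguments prob_vec R m : clear implicits.

Definition convex_combs (R : numDomainType) (E : lmodType R) (m : nat)
    (K : set E) : set E :=
  [set \sum_(i < m) w 0 i *: x i |
    w in prob_vec R m & x in [set x : 'I_m -> E | forall i, K (x i)]].
Arguments convex_combs {R E} m K.

(** With more than [\dim E + 1] points, the differences with the first one are
linearly dependent; the coefficient of the first point is chosen so that the
coefficients sum to zero. *)
Lemma affine_dependence (R : realFieldType) (E : vectType R) (m : nat)
    (x : 'I_m.+1 -> E) : (\dim {:E} < m)%N ->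
  exists c : 'I_m.+1 -> R,
    [/\ \sum_i c i = 0, \sum_i c i *: x i = 0 & exists i, 0 < c i].
Proof.
move=> dimE.
pose X := [tuple x (lift ord0 i) - x ord0 | i < m].
have [k] : exists k : 'I_m -> R,
    \sum_(i < m) k i *: X`_i = 0 /\ exists i, k i != 0.
  apply: contrapT => nk.
  have /eqP fX : free X.
    apply/freeP => k kX i; apply: contrapT => /eqP ki.
    by apply: nk; exists k; split=> //; exists i.
  by have := dimvS (subvf <<X>>%VS); rewrite fX size_tuple leqNgt dimE.
move=> [kX [i0 ki0]].
pose c (i : 'I_m.+1) : R :=
  if unlift ord0 i is Some j then k j else - \sum_j k j.
have c0 : c ord0 = - \sum_j k j by rewrite /c unlift_none.
have cl j : c (lift ord0 j) = k j by rewrite /c liftK.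
have sumc : \sum_i c i = 0.
  by rewrite big_ord_recl c0 (eq_bigr _ (fun j _ => cl j)) addNr.
exists c; split=> //.
- rewrite big_ord_recl c0 (eq_bigr (fun j => k j *: x (lift ord0 j)));
    last by move=> j _; rewrite cl.
  rewrite scaleNr addrC scaler_suml -sumrB -[RHS]kX; apply: eq_bigr => j _.
  by rewrite -scalerBr (nth_map j) ?size_enum_ord // nth_ord_enum.
(* Otherwise every [- c i] is nonnegative; they sum to zero, so all vanish. *)
- apply: contrapT => npos.
  have cle i : 0 <= - c i.
    by rewrite oppr_ge0 leNgt; apply/negP => ci; apply: npos; exists i.
  have := psumr_eq0P (fun i (_ : true) => cle i) _ (i := lift ord0 i0) isT.
  rewrite cl sumrN sumc oppr0 => /(_ erefl)/eqP.
  by rewrite oppr_eq0 (negPf ki0).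
Qed.

(** One step of Caratheodory's theorem: subtracting from the weights the largest
multiple of an affine dependence that keeps them nonnegative makes one of them
vanish, and the corresponding point can be dropped. *)
Lemma caratheodory (R : realFieldType) (E : vectType R) (m : nat) (K : set E) :
  (\dim {:E} < m)%N -> convex_combs m.+1 K `<=` convex_combs m K.
Proof.
move=> dimE _ [w [w_ge0 w_sum]] [x Kx <-].
have [c [c_sum cx [i1 ci1]]] := affine_dependence x dimE.
(* The weight that reaches zero first minimizes [w i / c i] over [c i > 0]. *)
case: (@Order.TotalTheory.arg_minP _ _ _ i1 (fun i => 0 < c i)
  (fun i => w 0 i / c i) ci1) => i0 ci0 i0min.
pose t := w 0 i0 / c i0.
have t_ge0 : 0 <= t by rewrite divr_ge0 // ltW.
pose w' i := w 0 i - t * c i.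
have w'0 : w' i0 = 0 by rewrite /w' /t divfK ?subrr // gt_eqF.
have w'_ge0 i : 0 <= w' i.
  rewrite subr_ge0; have [ci|ci] := ltP 0 (c i).
    by rewrite -ler_pdivlMr //; exact: i0min.
  by apply: (le_trans _ (w_ge0 i)); rewrite mulr_ge0_le0.
have dropi0 (V : nmodType) (F : 'I_m.+1 -> V) : F i0 = 0 ->
    \sum_(i < m) F (lift i0 i) = \sum_i F i.
  by move=> F0; rewrite (bigD1_ord i0) //= F0 add0r.
exists (\row_i w' (lift i0 i)).
  split=> [i|]; first by rewrite mxE.
  under eq_bigr do rewrite mxE.
  by rewrite (dropi0 _ w') // sumrB -mulr_sumr c_sum mulr0 subr0.
exists (fun i => x (lift i0 i)) => [i|]; first exact: Kx.
under eq_bigr do rewrite mxE.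
rewrite (dropi0 _ (fun i => w' i *: x i)) ?w'0 ?scale0r //.
under eq_bigr do rewrite scalerBl -scalerA.
by rewrite sumrB -scaler_sumr cx scaler0 subr0.
Qed.

Lemma convex_combs_cons (R : realFieldType) (E : lmodType R) (m : nat)
    (K : set E) (k p : E) (t : R) : 0 <= t <= 1 ->
  K k -> convex_combs m K p -> convex_combs m.+1 K (t *: k + (1 - t) *: p).
Proof.
move=> /andP[t0 t1] Kk [w [w_ge0 w_sum] [x Kx <-]].
exists (\row_i if unlift ord0 i is Some j then (1 - t) * w 0 j else t).
  split=> [i|].
    by rewrite mxE; case: unliftP => [j|] _ //; rewrite mulr_ge0 ?subr_ge0.
  rewrite big_ord_recl mxE unlift_none.
  under eq_bigr do rewrite mxE liftK.
  by rewrite -mulr_sumr w_sum mulr1 subrKC.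
exists (fun i => if unlift ord0 i is Some j then x j else k) => [i /=|].
  by case: unliftP.
rewrite big_ord_recl mxE unlift_none scaler_sumr; congr (_ + _).
by apply: eq_bigr => j _; rewrite mxE liftK scalerA.
Qed.

Lemma convex_combs_point (R : numFieldType) (E : lmodType R) (m : nat)
    (K : set E) : K `<=` convex_combs m.+1 K.
Proof.
move=> k Kk.
have w_sum : \sum_(i < m.+1) m.+1%:R^-1 = 1 :> R.
  by rewrite sumr_const card_ord -[LHS]mulr_natr mulVf ?pnatr_eq0.
exists (const_mx m.+1%:R^-1).
  split=> [i|]; first by rewrite mxE invr_ge0.
  by under eq_bigr do rewrite mxE.
exists (fun=> k) => //.
under eq_bigr do rewrite mxE.
by rewrite -scaler_suml w_sum scale1r.
Qed.

Lemma convex_setP (R : numDomainType) (E : lmodType R) (A : set E) (t : R)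
    (x y : E) :
  convex_set A -> 0 <= t <= 1 -> A x -> A y -> A (t *: x + (1 - t) *: y).
Proof.
move=> Acvx /andP[t0 t1] /mem_set Ax /mem_set Ay.
exact: set_mem (Acvx _ _ (Itv01 t0 t1) Ax Ay).
Qed.

Lemma convex_combs_sub (R : realFieldType) (E : lmodType R) (m : nat)
    (K A : set E) : convex_set A -> K `<=` A -> convex_combs m K `<=` A.
Proof.
move=> Acvx KA; elim: m => [|m IHm] _ [w [w_ge0 w_sum] [x Kx <-]].
  by move: w_sum; rewrite big_ord0 => /eqP; rewrite eq_sym oner_eq0.
rewrite big_ord_recl; move: w_sum; rewrite big_ord_recl.
set w0 := w 0 ord0; set s := \sum_(i < m) _ => w_sum.
have s_ge0 : 0 <= s by apply: sumr_ge0.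
have [s0|s_neq0] := eqVneq s 0.
  have wl0 i : w 0 (lift ord0 i) = 0.
    exact: (psumr_eq0P (fun i _ => w_ge0 (lift ord0 i)) s0).
  rewrite big1 => [|i _]; last by rewrite wl0 scale0r.
  by rewrite addr0 -[w0]addr0 -s0 w_sum scale1r; exact/KA/Kx.
have w01 : 0 <= w0 <= 1 by rewrite w_ge0 -w_sum lerDl.
have Aq : A (\sum_(i < m) (w 0 (lift ord0 i) / s) *: x (lift ord0 i)).
  apply: IHm; exists (\row_i (w 0 (lift ord0 i) / s)).
    split=> [i|]; first by rewrite mxE divr_ge0.
    by under eq_bigr do rewrite mxE; rewrite -mulr_suml divff.
  exists (fun i => x (lift ord0 i)) => [i|]; first exact: Kx.
  by apply: eq_bigr => i _; rewrite mxE.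
have := convex_setP Acvx w01 (KA _ (Kx ord0)) Aq.
have -> : 1 - w0 = s by rewrite -w_sum addrC addKr.
rewrite scaler_sumr => H; congr (A (_ + _)): H.
by apply: eq_bigr => i _; rewrite scalerA mulrCA divff ?mulr1.
Qed.

(** * Compactness and continuity *)

Lemma compact_prob_vec (R : realType) (m : nat) : compact (prob_vec R m).
Proof.
have cont_sum : continuous (fun w : 'rV[R]_m => \sum_i w 0 i).
  apply: continuous_big => [|i _]; first exact: add_continuous.
  exact: coord_continuous.
have box := rV_compact (fun i : 'I_m => @segment_compact R 0 1).
apply: subclosed_compact box _ => [|w [w_ge0 w_sum] i].
  have -> : prob_vec R m =
      \bigcap_i ((fun w : 'rV[R]_m => w 0 i) @^-1` [set x | 0 <= x]) `&`
      (fun w : 'rV[R]_m => \sum_i w 0 i) @^-1` [set x | x = 1].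
    apply/seteqP; split=> w [w_ge0 w_sum]; split=> // i; last exact: w_ge0.
    by move=> _; exact: w_ge0.
  apply: closedI; last first.
    by apply: preimage_closed (@closed_eq _ _) => w _; exact: cont_sum.
  apply: closed_bigI => i _.
  by apply: preimage_closed (@closed_ge _ _) => w _; exact: coord_continuous.
rewrite /= in_itv /= w_ge0 -w_sum (bigD1 i) //= lerDl.
by apply: sumr_ge0 => j _; exact: w_ge0.
Qed.

Section compactness_of_convex_combs.
Import ArrowAsProduct.

(** The set is the image of the compact product of the weights and of [K ^ m]
under a continuous map. *)
Lemma compact_convex_combs (R : realType) (E : normedModType R) (m : nat)
    (K : set E) : compact K -> compact (convex_combs m K).
Proof.
move=> Kcpt.
pose f (p : 'rV[R]_m * ('I_m -> E)) : E := \sum_(i < m) p.1 0 i *: p.2 i.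
have -> : convex_combs m K =
    f @` (prob_vec R m `*` [set x | forall i, K (x i)]).
  apply/seteqP; split=> [_ [w hw [x hx <-]]|_ [[w x] [hw hx] <-]].
    by exists (w, x).
  by exists w => //; exists x.
apply: continuous_compact; last first.
  apply: compact_setX (compact_prob_vec (m := m)) _.
  by apply: (@tychonoff 'I_m (fun=> E) (fun=> K)) => _.
apply: continuous_subspaceT.
apply: continuous_big => [|i _]; first exact: add_continuous.
have wi_cont : continuous (fun p : 'rV[R]_m * ('I_m -> E) => p.1 0 i).
  move=> p; apply: (cvg_comp fst (fun w : 'rV[R]_m => w 0 i) cvg_fst).
  exact: coord_continuous.
have xi_cont : continuous (fun p : 'rV[R]_m * ('I_m -> E) => p.2 i).
  move=> p; apply: (cvg_comp snd (fun x : 'I_m -> E => x i) cvg_snd).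
  exact: (@proj_continuous 'I_m (fun=> E) i).
by move=> p; exact: (cvgZ (wi_cont p) (xi_cont p)).
Qed.

End compactness_of_convex_combs.

Lemma continuous_row (R : realType) (T : topologicalType) (m : nat)
    (f : 'I_m -> T -> R) :
  (forall i, continuous (f i)) -> continuous (fun t => \row_i f i t).
Proof.
move=> fcont t W [P Pnbhs PW].
have : \forall s \near t, forall j, P 0 j (f j s).
  apply: filter_forall => j; apply: fcont.
  by have := Pnbhs 0 j; rewrite mxE.
rewrite nbhs_filterE /=; apply: filterS => s Ps; apply: PW => i j.
by rewrite ord1 mxE; exact: Ps.
Qed.

(** A cluster point in [A] of the image filter lifts to the subtype, whose open
sets are the traces of open sets. *)
Lemma compact_set_type (T : topologicalType) (A : set T) :
  compact A -> compact [set: set_type A].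
Proof.
move=> Acpt F FF _.
have := Acpt (set_val @ F) _.
case=> [|p [Ap pF]].
  by rewrite nbhs_filterE /=; apply: filterS filterT => x _; exact: set_valP.
exists (SigSub (mem_set Ap)); split=> // U W FU /= [] _ [ [B Bop <-] /= Bp BW].
have FU' : F (set_val @^-1` (set_val @` U)).
  by apply: filterS FU => x Ux; exists x.
have [_ [ [x Ux <-] Bx]] := pF _ _ FU' (open_nbhs_nbhs (conj Bop Bp)).
by exists x; split=> //; exact: BW.
Qed.

(** * Mixtures of probability measures and integrals of continuous functions *)

Section mixture.
Context d (T : measurableType d) (R : realType).
Variables (p : {i01 R}) (P Q : probability T R).

Definition mixture : set T -> \bar R :=
  measure_add (mscale (p%:num)%:nng P) (mscale (1 - p%:num)%:nng Q).

HB.instance Definition _ := Measure.on mixture.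

Let mixtureT : mixture setT = 1%E.
Proof.
rewrite /mixture measure_addE /= /mscale /=.
by rewrite !probability_setT !mule1 -EFinD subrKC.
Qed.

HB.instance Definition _ := Measure_isProbability.Build _ _ _ mixture mixtureT.

End mixture.

Section Rintegral_extra.
Context d (T : measurableType d) (R : realType).

Lemma integral_mscale (m : {measure set T -> \bar R}) (D : set T)
    (k : {nonneg R}) (f : T -> \bar R) : measurable D -> m.-integrable D f ->
  (\int[mscale k m]_(x in D) f x = k%:num%:E * \int[m]_(x in D) f x)%E.
Proof.
move=> mD intf; have mf := measurable_int _ intf.
rewrite [LHS]integralE [X in (_ = _ * X)%E]integralE muleBr //; last first.
  by apply: fin_num_adde_defr; exact: integrable_pos_fin_num.
have mfp := measurable_funepos mf.
have mfn := measurable_funeneg mf.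
by rewrite !ge0_integral_mscale.
Qed.

Lemma integrable_mscale (m : {measure set T -> \bar R}) (D : set T)
    (k : {nonneg R}) (f : T -> \bar R) : measurable D -> m.-integrable D f ->
  (mscale k m).-integrable D f.
Proof.
move=> mD /integrableP[mf foo]; apply/integrableP; split=> //.
rewrite ge0_integral_mscale //; last exact: measurableT_comp.
by rewrite lte_mul_pinfty.
Qed.

Lemma Rintegral_mixture (p : {i01 R}) (P Q : probability T R) (f : T -> R) :
  P.-integrable setT (EFin \o f) -> Q.-integrable setT (EFin \o f) ->
  \int[mixture p P Q]_x f x =
    p%:num * \int[P]_x f x + (1 - p%:num) * \int[Q]_x f x.
Proof.
move=> intP intQ; have mf := measurable_int _ intP.
have intPp : (mscale (p%:num)%:nng P).-integrable setT (EFin \o f).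
  exact: integrable_mscale.
have intQp : (mscale (1 - p%:num)%:nng Q).-integrable setT (EFin \o f).
  exact: integrable_mscale.
rewrite /Rintegral (integral_measure_add _ intPp intQp) //.
rewrite !integral_mscale // fineD ?fin_numM ?integrable_fin_num //.
by rewrite !fineM ?integrable_fin_num.
Qed.

Lemma Rintegral_dirac (a : T) (f : T -> R) :
  measurable_fun setT f -> \int[dirac a]_x f x = f a.
Proof.
move=> mf; rewrite /Rintegral integral_dirac //; last exact/measurable_EFinP.
by rewrite diracT mul1e.
Qed.

Lemma Rintegral_cst_probability (P : probability T R) (r : R) :
  \int[P]_x r = r.
Proof. by rewrite Rintegral_cst //= probability_setT mulr1. Qed.

Lemma Rintegral_lin_comb (P : {measure set T -> \bar R}) (I : finType)
    (c : I -> R) (f : I -> T -> R) :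
  (forall i, P.-integrable setT (EFin \o f i)) ->
  \int[P]_x (\sum_i c i * f i x) = \sum_i c i * \int[P]_x f i x.
Proof.
move=> intf; elim: (index_enum I) => [|i s IHs].
  under eq_Rintegral do rewrite big_nil.
  by rewrite big_nil Rintegral_cst // mul0r.
have intc j : P.-integrable setT (EFin \o (fun x => c j * f j x)).
  exact: (integrableZl _ (c j) (intf j)).
under eq_Rintegral do rewrite big_cons.
rewrite big_cons RintegralD // ?IHs ?RintegralZl //.
have -> : EFin \o (fun x => \sum_(j <- s) c j * f j x) =
    (fun x => \sum_(j <- s) (c j * f j x)%:E)%E.
  by apply/funext => x /=; rewrite -sumEFin.
by apply: integrable_sum => // j _; exact: intc.
Qed.

End Rintegral_extra.

Section continuous_on_compact.
Context (R : realType) (T : ptopologicalType).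
Implicit Type f : T -> R.

Lemma continuous_borel_measurable f :
  continuous f -> measurable_fun setT (f : borel T -> R).
Proof.
move=> /continuousP fcont; apply: (measurability _ (RGenOpens.measurableE R)).
move=> _ [_ [a [b ->] <-]]; rewrite setTI.
by apply: sub_sigma_algebra; apply: fcont; exact: interval_open.
Qed.

Lemma compact_continuous_integrable
    (P : {finite_measure set (borel T) -> \bar R}) f :
  compact [set: T] -> continuous f ->
  P.-integrable setT (EFin \o (f : borel T -> R)).
Proof.
move=> Tcpt fcont; apply: measurable_bounded_integrable => //.
- exact: fin_num_fun_lty.
- exact: continuous_borel_measurable.
have /compact_bounded[M [Mreal fM]] : compact (f @` [set: T]).
  by apply: continuous_compact Tcpt; exact: continuous_subspaceT.
exists M; split=> // N MN x _; exact: fM.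
Qed.

End continuous_on_compact.

(** * Euclidean projection on a compact set *)

Section nearest_point.
Context (R : realType) (a b : nat).
Local Notation E := ('rV[R]_a * 'rV[R]_b)%type.
Implicit Types (p q k z : E) (C : set E).

(** The coordinates of both components are indexed together so that the
Euclidean geometry of the product space is that of a single sum. *)
Definition coord p (s : 'I_a + 'I_b) : R :=
  match s with inl i => p.1 0 i | inr j => p.2 0 j end.

Lemma coord_inj p q : coord p =1 coord q -> p = q.
Proof.
case: p q => [p1 p2] [q1 q2] pq; congr (_, _); apply/rowP => i.
  exact: (pq (inl i)).
exact: (pq (inr i)).
Qed.

Lemma coord_conv (t : R) p q s :
  coord (t *: p + (1 - t) *: q) s = t * coord p s + (1 - t) * coord q s.
Proof. by case: s => i; rewrite /= !mxE. Qed.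

Lemma continuous_coord s : continuous (coord ^~ s).
Proof.
case: s => i p /=.
  apply: (cvg_comp fst (fun w : 'rV[R]_a => w 0 i) cvg_fst).
  exact: coord_continuous.
apply: (cvg_comp snd (fun w : 'rV[R]_b => w 0 i) cvg_snd).
exact: coord_continuous.
Qed.

(** A point [p] of [C] at minimal Euclidean distance from [z].  If the segment
from [p] to [k] stays in [C], the squared distance from [z] to
[p + t (k - p)], a quadratic polynomial in [t], is minimal on [[0, 1]] at
[t = 0], so its derivative there is nonnegative. *)
Lemma nearest_point C z : C !=set0 -> compact C ->
  exists2 p, C p & forall k,
    (forall t, 0 <= t <= 1 -> C (t *: k + (1 - t) *: p)) ->
    \sum_s (coord z s - coord p s) * (coord k s - coord p s) <= 0.
Proof.
move=> C0 Ccpt.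
pose dist c := \sum_s (coord z s - coord c s) ^+ 2.
have dist_cont : continuous dist.
  apply: continuous_big => [|s _]; first exact: add_continuous.
  move=> c; apply: (continuous_comp (f := fun c => coord z s - coord c s)
    (g := fun x => x ^+ 2)); last exact: exprn_continuous.
  by apply: cvgB; [exact: cvg_cst|exact: continuous_coord].
have [p /set_mem Cp pmin] :=
  compact_EVT_min C0 Ccpt (continuous_subspaceT dist_cont).
exists p => // k segC.
set ip := \sum_s _; pose nk := \sum_s (coord k s - coord p s) ^+ 2.
have distE t : dist (t *: k + (1 - t) *: p) = dist p - 2 * t * ip + t ^+ 2 * nk.
  rewrite /dist /ip /nk !mulr_sumr -sumrB -big_split; apply: eq_bigr => s _.
  by rewrite /= coord_conv; ring.
have ip_le t : 0 <= t <= 1 -> 2 * t * ip <= t ^+ 2 * nk.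
  move=> t01; have := pmin _ (mem_set (segC t t01)).
  by rewrite distE; lra.
rewrite leNgt; apply/negP => ip_gt0.
have nk_ge : 2 * ip <= nk.
  by have := ip_le 1; rewrite expr1n !mulr1 mul1r; apply; lra.
have nk_gt0 : 0 < nk by lra.
(* [t = ip / nk] minimizes [t ^+ 2 * nk - 2 * t * ip], with a negative value. *)
have t01 : 0 <= ip / nk <= 1.
  by apply/andP; split; [exact/ltW/divr_gt0|rewrite ler_pdivrMr // mul1r; lra].
have := ip_le _ t01.
have -> : (ip / nk) ^+ 2 * nk = ip / nk * ip.
  by field; rewrite gt_eqF.
have : 0 < ip / nk * ip by rewrite mulr_gt0 // divr_gt0.
lra.
Qed.

End nearest_point.

(** * The graph as a convex hull *)

Section graph_as_convex_hull.
Context (R : realType) (X : finType) (X_gt0 : (0 < #|X|)%N) (n : nat).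
Variable V : 'I_n -> Delta R X_gt0 -> R.
Hypothesis contV : forall j, continuous (V j).
Local Notation D := (Delta R X_gt0).
Local Notation E := ('rV[R]_#|X| * 'rV[R]_n)%type.

Lemma Delta_val_inj : injective (@Delta_val R X X_gt0).
Proof. exact: val_inj. Qed.

Lemma Delta_valP (nu : D) : simplex R X (Delta_val nu).
Proof. exact: set_valP. Qed.

Lemma Delta_of w : simplex R X w -> exists nu : D, Delta_val nu = w.
Proof. by move=> /mem_set hw; exists (SigSub hw). Qed.

Lemma Delta_val_continuous : continuous (@Delta_val R X X_gt0).
Proof. exact: initial_continuous. Qed.

Lemma Delta_compact : compact [set: D].
Proof. exact/compact_set_type/compact_prob_vec. Qed.

(** The vector of moments of the Dirac mass at [nu]; the graph of the
correspondence is the convex hull of its range. *)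
Definition phi (nu : D) : E := (Delta_val nu, \row_j V j nu).

Lemma phi_continuous : continuous phi.
Proof.
move=> nu.
exact: cvg_pair (@Delta_val_continuous nu) (@continuous_row _ _ _ _ contV nu).
Qed.

Lemma range_phi_compact : compact (range phi).
Proof.
apply: continuous_compact Delta_compact.
exact: continuous_subspaceT phi_continuous.
Qed.

Lemma coord_phi_continuous s : continuous (fun nu => coord (phi nu) s).
Proof.
move=> nu; apply: (continuous_comp (f := phi) (g := fun p => coord p s)).
  exact: phi_continuous.
exact: continuous_coord.
Qed.

Lemma coord_phi_integrable (P : Delta2 R X_gt0) s :
  P.-integrable setT (EFin \o (fun nu : borel D => coord (phi nu) s)).
Proof.
apply: compact_continuous_integrable Delta_compact _.
exact: coord_phi_continuous.
Qed.

Definition moments (P : Delta2 R X_gt0) : E := (barycenter P, expectations V P).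

Lemma coord_moments (P : Delta2 R X_gt0) s :
  coord (moments P) s = \int[P]_nu coord (phi nu) s.
Proof.
case: s => i /=; rewrite !mxE //.
by under [RHS]eq_Rintegral do rewrite mxE.
Qed.

(** The total mass of the barycenter is the integral of the total mass, which
is the constant one. *)
Lemma barycenter_simplex (P : Delta2 R X_gt0) : simplex R X (barycenter P).
Proof.
split=> [i|].
  rewrite mxE; apply: Rintegral_ge0 => nu _.
  by have [+ _] := Delta_valP nu; apply.
transitivity (\sum_i 1 * \int[P]_nu (Delta_val (nu : D) 0 i)).
  by apply: eq_bigr => i _; rewrite mxE mul1r.
rewrite -Rintegral_lin_comb => [|i]; last first.
  exact: (coord_phi_integrable P (inl i)).
rewrite -[RHS](Rintegral_cst_probability P); apply: eq_Rintegral => nu _.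
have [_ nu_sum] := Delta_valP nu.
by rewrite -[RHS]nu_sum; apply: eq_bigr => i _; rewrite mul1r.
Qed.

Lemma graph_moments : graph (value_set V) = range moments.
Proof.
apply/seteqP; split=> [[p1 p2] [mu /= p1E [P Pmu <-]]|_ [P _ <-]].
  by exists P => //; rewrite /moments Pmu p1E.
have [mu muE] := Delta_of (barycenter_simplex P).
by exists mu => //; exists P.
Qed.

Lemma phi_graph : range phi `<=` graph (value_set V).
Proof.
move=> _ [nu _ <-]; rewrite graph_moments.
exists (dirac (nu : borel D)) => //; apply: coord_inj => s.
rewrite coord_moments Rintegral_dirac //.
by apply: continuous_borel_measurable; exact: coord_phi_continuous.
Qed.

Lemma graph_convex : @convex_set R E (graph (value_set V)).
Proof.
rewrite graph_moments => _ _ t /set_mem[P _ <-] /set_mem[Q _ <-].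
apply/mem_set; exists (mixture t P Q) => //; apply: coord_inj => s.
rewrite [RHS]coord_conv !coord_moments.
by rewrite Rintegral_mixture //; exact: coord_phi_integrable.
Qed.

(** A vector of moments is its own nearest point in the set of convex
combinations: the integral over [nu] of the angle condition at the nearest
point [p], with direction [phi nu], is [|moments P - p|^2 <= 0]. *)
Lemma graph_hull m : (\dim {:E} < m)%N ->
  graph (value_set V) = convex_combs m (range phi).
Proof.
move=> dimE; apply/seteqP; split; last first.
  exact: convex_combs_sub graph_convex phi_graph.
rewrite graph_moments => _ [P _ <-].
set C := convex_combs m _.
have C0 : C !=set0.
  case: m dimE @C => // m dimE.
  by exists (phi point); apply: convex_combs_point; exists point.
have Ccpt : compact C by apply: compact_convex_combs; exact: range_phi_compact.
have [p Cp pmin] := nearest_point (moments P) C0 Ccpt.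
suff -> : moments P = p by [].
pose c s := coord (moments P) s - coord p s.
(* The segment towards [phi nu] uses one more point, which can be dropped. *)
have c_le0 nu : \sum_s c s * (coord (phi nu) s - coord p s) <= 0.
  apply: pmin => t t01; apply: caratheodory dimE _ _.
  by apply: convex_combs_cons => //; exists nu.
pose g s nu := coord p s - coord (phi nu) s.
have g_int s : P.-integrable setT (EFin \o (g s : borel D -> R)).
  apply: compact_continuous_integrable Delta_compact _ => nu.
  exact: cvgB (cvg_cst (coord p s)) (@coord_phi_continuous s nu).
have int_g s : \int[P]_nu g s nu = - c s.
  have cst_int : P.-integrable setT (EFin \o (fun _ : borel D => coord p s)).
    apply: compact_continuous_integrable Delta_compact _.
    exact: cst_continuous.
  rewrite (RintegralB _ cst_int (coord_phi_integrable P s)) //.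
  by rewrite Rintegral_cst_probability -coord_moments opprB.
have : 0 <= \int[P]_nu (\sum_s c s * g s nu).
  apply: Rintegral_ge0 => nu _; rewrite -oppr_le0 -sumrN.
  apply: le_trans (c_le0 nu).
  by apply: ler_sum => s _; rewrite -mulrN opprB.
rewrite Rintegral_lin_comb //.
under eq_bigr do rewrite int_g mulrN.
rewrite sumrN oppr_ge0 => c2_le0.
have c2_ge0 s : true -> 0 <= c s * c s by rewrite -expr2 sqr_ge0.
have /eqP c2_0 : \sum_s c s * c s == 0 by rewrite eq_le c2_le0 sumr_ge0.
apply: coord_inj => s; apply/eqP; rewrite -subr_eq0 -sqrf_eq0 expr2.
by rewrite (psumr_eq0P c2_ge0 c2_0).
Qed.

Lemma graph_compact : compact (graph (value_set V)).
Proof.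
rewrite (graph_hull (ltnSn _)).
by apply: compact_convex_combs; exact: range_phi_compact.
Qed.

End graph_as_convex_hull.

(** * Hemicontinuity *)

Section hemicontinuity_of_value_set.
Context (R : realType) (X : finType) (X_gt0 : (0 < #|X|)%N) (n : nat).
Variable V : 'I_n -> Delta R X_gt0 -> R.
Hypothesis contV : forall j, continuous (V j).
Local Notation D := (Delta R X_gt0).
Local Notation E := ('rV[R]_#|X| * 'rV[R]_n)%type.

(** The points whose image is not contained in the open set [B] form the
projection of the part of the graph over the complement of [B]; that part is
compact, so its projection is closed. *)
Lemma compact_graph_uhc (F : D -> set 'rV[R]_n) :
  compact (graph F) -> upper_hemicontinuous F.
Proof.
move=> Gcpt mu B Bop FB.
pose bad := fst @` (graph F `&` snd @^-1` (~` B)) : set 'rV[R]_#|X|.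
have fst_continuous : continuous (fst : E -> _) by move=> p; exact: cvg_fst.
have snd_continuous : continuous (snd : E -> _) by move=> p; exact: cvg_snd.
have bad_closed : closed bad.
  apply: compact_closed; first exact: norm_hausdorff.
  apply: continuous_compact.
    by apply: continuous_subspaceT; exact: fst_continuous.
  apply: compact_closedI => //.
  by apply: preimage_closed (open_closedC Bop) => p _; exact: snd_continuous.
have mu_nbad : nbhs (Delta_val mu) (~` bad).
  apply: open_nbhs_nbhs; split; first exact: closed_openC.
  move=> [ [p1 p2] [ [mu' /= p1E Fp2] nB] p1mu]; apply: nB; apply: FB.
  by rewrite p1mu in p1E; rewrite (Delta_val_inj p1E).
have near_mu : \forall mu' \near mu, ~ bad (Delta_val mu').
  exact: (@Delta_val_continuous _ _ X_gt0 mu _ mu_nbad).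
apply: filterS near_mu => mu' nbad v Fv; apply: contrapT => nBv; apply: nbad.
by exists (Delta_val mu', v) => //; split=> //; exists mu'.
Qed.

(** The coordinatewise condition says that [mu' = lambda mu + (1 - lambda) rho]
with [rho] in the simplex.  The value at [mu'] is obtained by mixing a law that
achieves [v] at [mu] with the Dirac mass at [rho]. *)
Lemma value_set_split mu mu' v lambda : 0 <= lambda < 1 ->
  (forall i, lambda * Delta_val mu 0 i <= Delta_val mu' 0 i) ->
  value_set V mu v ->
  exists rho, value_set V mu' (lambda *: v + (1 - lambda) *: \row_j V j rho).
Proof.
move=> /andP[l0 l1] le_mu Fv.
have l1' : 0 < 1 - lambda by rewrite subr_gt0.
pose r := (1 - lambda)^-1 *: (Delta_val mu' - lambda *: Delta_val mu).
have r_simplex : simplex R X r.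
  have [_ mu_sum] := Delta_valP mu; have [_ mu'_sum] := Delta_valP mu'.
  split=> [i|]; first by rewrite !mxE mulr_ge0 ?invr_ge0 ?subr_ge0 // ltW.
  under eq_bigr do rewrite !mxE.
  by rewrite -mulr_sumr sumrB -mulr_sumr mu_sum mu'_sum mulr1 mulVf // gt_eqF.
have [rho rhoE] := Delta_of X_gt0 r_simplex; exists rho.
have l01 : 0 <= lambda <= 1 by rewrite l0 ltW.
have Gmu : graph (value_set V) (Delta_val mu, v) by exists mu.
have Grho : graph (value_set V) (phi V rho).
  by apply: phi_graph => //; exists rho.
have [mu'' /= mu''E Fmu''] := convex_setP (graph_convex contV) l01 Gmu Grho.
suff <- : mu'' = mu' by [].
apply: Delta_val_inj; rewrite -mu''E rhoE scalerA divff ?gt_eqF //.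
by rewrite scale1r addrC subrK.
Qed.

(** The loss in [value_set_split] is [1 - lambda] times a distance that is
bounded since [V] is; once [lambda] is fixed so that this is small, the
coordinatewise condition holds near [mu]. *)
Lemma value_set_lhc : lower_hemicontinuous (value_set V).
Proof.
move=> mu B Bop [v [Fv Bv]].
have /nbhs_normP[e /= e0 eB] : nbhs v B by exact: open_nbhs_nbhs.
have rowB_cont : continuous (fun rho : D => \row_j V j rho - v).
  by move=> rho; exact: cvgB (@continuous_row _ _ _ _ contV rho) (cvg_cst v).
have /compact_bounded[M0 [_ VM]] :=
  continuous_compact (continuous_subspaceT rowB_cont)
    (@Delta_compact R X X_gt0).
pose M := `|M0| + 1.
have M_gt0 : 0 < M by rewrite ltr_wpDl.
have {}VM rho : `|\row_j V j rho - v| <= M.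
  apply: (VM M); last by exists rho.
  by rewrite /M (le_lt_trans (ler_norm _)) // ltrDl.
(* [s] stands for [1 - lambda]; any [s] in [(0, 1]] with [s * M < e] will do. *)
pose s := e / (e + M + M).
have e_gt0 : 0 < e := e0.
have eM_gt0 : 0 < e + M + M by lra.
have s0 : 0 < s by rewrite divr_gt0.
have s1 : s <= 1 by rewrite ler_pdivrMr ?mul1r //; lra.
have sM : s * M < e.
  by rewrite /s mulrAC ltr_pdivrMr // ltr_pM2l //; lra.
have near_mu : \forall mu' \near mu, forall i,
    (1 - s) * Delta_val mu 0 i <= Delta_val mu' 0 i.
  apply: (@filter_forall _ _ _ (nbhs mu)) => i.
  have [mu_ge0 _] := Delta_valP mu.
  have [mui0|mui_neq0] := eqVneq (Delta_val mu 0 i) 0.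
    rewrite mui0 mulr0; apply: nearW => mu'.
    by have [+ _] := Delta_valP mu'; apply.
  have mui_gt0 : 0 < Delta_val mu 0 i by rewrite lt_def mui_neq0 mu_ge0.
  have coord_mu : (fun mu' : D => Delta_val mu' 0 i) @ mu --> Delta_val mu 0 i.
    exact: (@coord_phi_continuous _ _ _ _ _ contV (inl i) mu).
  have lt_mui : (1 - s) * Delta_val mu 0 i < Delta_val mu 0 i.
    by rewrite gtr_pMl // gtrBl.
  exact: cvgr_ge coord_mu _ lt_mui.
apply: filterS near_mu => mu' le_mu.
have l01 : 0 <= 1 - s < 1 by rewrite subr_ge0 s1 gtrBl.
have [rho Frho] := value_set_split l01 le_mu Fv.
exists ((1 - s) *: v + (1 - (1 - s)) *: \row_j V j rho); split=> //.
apply: eB => /=.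
have -> : v - ((1 - s) *: v + (1 - (1 - s)) *: \row_j V j rho) =
    - (s *: (\row_j V j rho - v)).
  rewrite subKr scalerBl scale1r scalerBr opprB -addrA.
  by rewrite opprD addrA subrr add0r opprD opprK.
rewrite normrN normrZ gtr0_norm //.
by rewrite (le_lt_trans _ sM) // ler_pM2l.
Qed.

End hemicontinuity_of_value_set.

Theorem lemma3 (R : realType) (X : finType) (X_gt0 : (0 < #|X|)%N) (n : nat)
    (V : 'I_n -> Delta R X_gt0 -> R) (contV : forall j, continuous (V j)) :
  [/\ upper_hemicontinuous (value_set V),
      lower_hemicontinuous (value_set V),
      @convex_set R ('rV[R]_#|X| * 'rV[R]_n)%type (graph (value_set V)) &
      compact (graph (value_set V))].
Proof.
have Gcpt := graph_compact contV.
split=> //; [exact: compact_graph_uhc|exact: value_set_lhc|exact: graph_convex].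
Qed.
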